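(* Let $(\mathcal{Q}_N)_{N\in\mathbb{N}}$, $\mathcal{Q}_N=(V_N,E_N,L_N,\mathbf{n}_N)$, be a sequence of finite quantum graphs such that: (Bounds) there exist $D,n_0\in\mathbb{N}$ and $0<L_{min}\le L_{max}$ such that for all $N$: $d(v)\le D$ and $\mathbf{n}_N(v)\le n_0$ for all $v\in V_N$, and $L_{min}\le L_N(e)\le L_{max}$ for all $e\in E_N$; (Unbalanced) for all $N$ and all $v\in V_N$, $\mathbf{n}_N(v)\neq d(v)$. Then for all $N$, $$\mathrm{Res}(\mathcal{Q}_N)\subset\mathbb{R}+i\left[-\frac{1}{L_{min}}\sup_{v\in V_N}\big(\ln(\mathbf{n}_N(v)+d(v))-\ln|d(v)-\mathbf{n}_N(v)|\big),\,0\right].$$ In particular, $$\mathrm{Res}(\mathcal{Q}_N)\subset\mathbb{R}+i\left[-\frac{\ln(D+n_0)}{L_{min}},0\right].$$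
   Context: A quantum graph $\mathcal{Q}=(V,E,L,\mathbf{n})$ consists of a graph $(V,E)$, a length map $L:E\to(0,\infty)$ and a map $\mathbf{n}:V\to\mathbb{N}\cup\{0\}$ ($\mathbf{n}(v)$ is the number of semi-infinite edges, called leads, attached to $v$). It is finite if $(V,E)$ is finite. $d(v)$ is the number of edges in $E$ to which $v$ belongs. $B$ is the set of oriented edges (bonds); $b\in B$ has origin $o(b)$, reverse $\hat b$ and length $L_b$ equal to that of the underlying edge. $B_{ext}=\{(v,k):v\in V,1\le k\le\mathbf{n}(v)\}$ with $o((v,k))=v$; $\hat B=B\cup B_{ext}$. $C^2(\mathcal{Q})$ is the set of families $f=(f_b)_{b\in\hat B}$ with $f_b\in C^2([0,L_b])$ for $b\in B$, $f_b\in C^2([0,\infty))$ for $b\in B_{ext}$, and $f_b(\cdot)=f_{\hat b}(L_b-\cdot)$ for $b\in B$. Such $f$ satisfies Kirchhoff conditions if $f_b(0)=f_{b'}(0)$ whenever $o(b)=o(b')$, and $\sum_{b\in\hat B:\,o(b)=v}f_b'(0)=0$ for all $v\in V$. A number $z\in\mathbb{C}$ is a (scattering) resonance of a finite quantum graph $\mathcal{Q}$ if there is a nonzero $f\in C^2(\mathcal{Q})$ such that $f$ satisfies Kirchhoff conditions, $-f_b''=z^2f_b$ for all $b\in\hat B$, and $f_b(x)=f_b(0)e^{izx}$ for all $b\in B_{ext}$. $\mathrm{Res}(\mathcal{Q})\subset\mathbb{C}$ is the set of resonances of $\mathcal{Q}$. *)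

(* Defs.v *)
From mathcomp Require Import all_boot all_order all_algebra.
From mathcomp Require Import all_classical all_reals all_analysis.
From mathcomp Require Import complex.

Set Implicit Arguments.
Unset Strict Implicit.
Unset Printing Implicit Defensive.

Import Order.TTheory GRing.Theory Num.Theory.
Import numFieldNormedType.Exports.

Local Open Scope classical_set_scope.
Local Open Scope ring_scope.
Local Open Scope complex_scope.

(* Complex-valued functions on a subset D of the real line.  Such a function
   is a total function R -> R[i] whose values outside D are irrelevant; at an
   end point of D the derivative below is one-sided.  The alias R[i]^o carries
   the topology of the complex modulus. *)
Section C2.
Context {R : realType}.
Implicit Types (D : set R) (f : R -> R[i]).

Definition diff_quotient f (x y : R) : R[i]^o := (f y - f x) / (y - x)%:C.

Definition derivable_in D f (x : R) : Prop :=
  cvg (diff_quotient f x y @[y --> within D x^']).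

Definition derive_in D f (x : R) : R[i] :=
  lim (diff_quotient f x y @[y --> within D x^']).

Definition C2_in D f : Prop :=
  [/\ forall x, D x -> derivable_in D f x,
      forall x, D x -> derivable_in D (derive_in D f) x
    & {within D, continuous (derive_in D (derive_in D f) : R -> R[i]^o)}].

Definition cexp (z : R[i]) : R[i] :=
  (expR (complex.Re z))%:C * (cos (complex.Im z) +i* sin (complex.Im z)).

End C2.

(* The underlying graph is simple: an edge is an unordered pair of distinct
   vertices.  Only the values of qlength on qedges matter. *)
Record finite_quantum_graph (R : realType) := FiniteQuantumGraph {
  qvertex : finType;
  qedges : {set {set qvertex}};
  qedges_card2 : forall e, e \in qedges -> #|e| = 2;
  qlength : {set qvertex} -> R;
  qlength_gt0 : forall e, e \in qedges -> 0 < qlength e;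
  qleads : qvertex -> nat
}.

Section QuantumGraph.
Context {R : realType} (Q : finite_quantum_graph R).

Definition degree (v : qvertex Q) : nat := #|[set e in qedges Q | v \in e]%SET|.

Definition bond : Type :=
  {p : qvertex Q * qvertex Q | ([set p.1; p.2] \in qedges Q)%SET}.

Definition bond_edge (b : bond) : {set qvertex Q} :=
  [set (val b).1; (val b).2]%SET.

Definition bond_length (b : bond) : R := qlength (bond_edge b).

Lemma bond_rev_subproof (b : bond) :
  ([set (val b).2; (val b).1] \in qedges Q)%SET.
Proof. by rewrite finset.setUC; exact: (valP b). Qed.

Definition bond_rev (b : bond) : bond :=
  exist _ ((val b).2, (val b).1) (bond_rev_subproof b).

Definition lead : Type := {v : qvertex Q & 'I_(qleads v)}.

Definition hbond : Type := (bond + lead)%type.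

Definition origin (b : hbond) : qvertex Q :=
  match b with inl b => (val b).1 | inr l => tag l end.

Definition bond_domain (b : hbond) : set R :=
  match b with inl b => `[0, bond_length b] | inr _ => `[0, +oo[ end.

Implicit Type f : hbond -> R -> R[i].

Definition in_C2 f : Prop :=
  (forall b : hbond, C2_in (bond_domain b) (f b)) /\
  (forall (b : bond) (x : R), bond_domain (inl b) x ->
     f (inl b) x = f (inl (bond_rev b)) (bond_length b - x)).

Definition kirchhoff f : Prop :=
  (forall b b' : hbond, origin b = origin b' -> f b 0 = f b' 0) /\
  (forall v : qvertex Q,
     \sum_(b : hbond | origin b == v) derive_in (bond_domain b) (f b) 0 = 0).

Definition is_resonance (z : R[i]) : Prop :=
  exists f : hbond -> R -> R[i],
    [/\ in_C2 f,
        exists (b : hbond) (x : R), bond_domain b x /\ f b x <> 0,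
        kirchhoff f,
        forall (b : hbond) (x : R), bond_domain b x ->
          - derive_in (bond_domain b) (derive_in (bond_domain b) (f b)) x
          = z ^+ 2 * f b x
      & forall (l : lead) (x : R), bond_domain (inr l) x ->
          f (inr l) x = f (inr l) 0 * cexp ('i%C * z * x%:C)].

Definition resonances : set R[i] := [set z | is_resonance z].

End QuantumGraph.

(* The horizontal strip R + i [a, b]. *)
Definition strip {R : realType} (a b : R) : set R[i] :=
  [set x +i* y | x in [set: R] & y in `[a, b]].

(* Main.v *)
Require Import Defs.
From mathcomp Require Import all_boot all_order all_algebra.
From mathcomp Require Import all_classical all_reals all_analysis.
From mathcomp Require Import complex.
From mathcomp Require Import ring lra.

Import Order.TTheory GRing.Theory Num.Theory.
Import numFieldNormedType.Exports.

Local Open Scope classical_set_scope.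
Local Open Scope ring_scope.

(* Let [P_b = f_b'(0) + iz f_b(0)] and [I_b = f_b'(0) - iz f_b(0)] be ([2iz]
   times, up to sign) the outgoing and incoming wave amplitudes at the origin
   of [b].  Both [f' + iz f] and [f' - iz f] solve first-order equations, so
   [I_{rev b} = - P_b exp(iz L_b)], and [I] vanishes on leads when [z] is not
   real.  At a vertex [v] of degree [d] with [n] leads, [P - I] is a constant
   [c] and [P + I] has sum zero, whence [sum |I|^2 = sum |P|^2]; eliminating the
   leads by Cauchy-Schwarz also gives
   [(d - n)^2 sum |I|^2 <= (d + n)^2 sum |P|^2] over the bonds at [v].
   Summing over all vertices, the first relation forces [P = 0] when
   [exp(-2 Im z L_b) < 1], i.e. [Im z > 0], and the second one when
   [exp(-2 Im z L_b) > ((d + n) / (d - n))^2]. *)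

(** * One-sided derivatives of real and complex functions, and the equation [g' = w g] on a
    segment *)

Section DerivativeWithin.
Set Implicit Arguments.
Unset Strict Implicit.
Local Open Scope complex_scope.
Variable R : realType.
Implicit Types (D : set R) (u v : R -> R) (f g : R -> R[i]) (x l : R).

Definition has_derivative_in D u x l :=
  (u y - u x) / (y - x) @[y --> within D x^'] --> l.

Lemma normc_ge_Im (w : R[i]) : `|complex.Im w|%:C <= `|w|.
Proof.
case: w => a b; rewrite normc_def lecR /= -sqrtr_sqr ler_sqrt ?addr_ge0 ?sqr_ge0 //.
by rewrite lerDr sqr_ge0.
Qed.

(** The increment [y - x] is real, so the quotient splits into real and imaginary parts, each
    bounded by the modulus. This moves everything to real functions, where the mean value theorem
    applies. *)
Lemma derivable_inP D f x : derivable_in D f x ->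
  has_derivative_in D (fun y => complex.Re (f y)) x (complex.Re (derive_in D f x)) /\
  has_derivative_in D (fun y => complex.Im (f y)) x (complex.Im (derive_in D f x)).
Proof.
move=> /cvgrPdist_lt df.
split; apply/cvgrPdist_lt => e e0; have e0' : 0 < e%:C by rewrite ltcR.
all: apply: filterS (df _ e0') => y.
all: rewrite /diff_quotient -/(derive_in D f x) -ltcR => H; apply: le_lt_trans H.
  apply: le_trans (normc_ge_Re _); rewrite lecR.
  case: (derive_in D f x) => a b; case: (f x) => c d; case: (f y) => p q.
  by rewrite -fmorphV /=; simpc.
apply: le_trans (normc_ge_Im _); rewrite lecR.
case: (derive_in D f x) => a b; case: (f x) => c d; case: (f y) => p q.
by rewrite -fmorphV /=; simpc.
Qed.

Lemma has_derivative_inD D u v x l k :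
  has_derivative_in D u x l -> has_derivative_in D v x k ->
  has_derivative_in D (u \+ v) x (l + k).
Proof.
move=> Hu Hv; rewrite /has_derivative_in.
under eq_fun do rewrite /= opprD addrACA mulrDl.
exact: cvgD.
Qed.

Lemma has_derivative_inZ D c u x l : has_derivative_in D u x l ->
  has_derivative_in D (fun y => c * u y) x (c * l).
Proof.
move=> Hu; rewrite /has_derivative_in.
under eq_fun do rewrite /= -mulrBr -mulrA.
by apply: cvgM => //; exact: cvg_cst.
Qed.

Lemma has_derivative_in_subset A D u x l : A `<=` D ->
  has_derivative_in D u x l -> has_derivative_in A u x l.
Proof.
move=> AD; apply: cvg_trans; apply: cvg_app.
by move=> P; apply: (@filterS _ (x^')) => y H /AD; exact: H.
Qed.

Lemma has_derivative_in_is_derive D u x l : nbhs x D ->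
  has_derivative_in D u x l -> is_derive x 1 u l.
Proof.
move=> nD H.
have H' : h^-1 *: ((u \o shift x) (h *: (1 : R^o)) - u x) @[h --> 0^'] -->
    (l : R^o).
  have shx : (h:R) + x @[h --> 0^'] --> within D x^'.
    move=> P HP.
    have HP' : \forall y \near x, y != x -> P y.
      have HPx : \forall y \near x, y != x -> D y -> P y by [].
      by apply: filterS2 nD HPx => y Dy H' yx; exact: H'.
    rewrite (near_shift 0) /= subr0 in HP'.
    apply: (@filterS _ (nbhs (0:R)) _ _ _ _ HP') => h hh h0 /=.
    by apply: hh; rewrite -subr_eq0 addrK.
  have := cvg_comp _ _ shx H.
  apply: cvg_trans; apply: near_eq_cvg; near=> h.
  by rewrite /= /GRing.scale /= mulr1 addrK mulrC.
by apply: DeriveDef; [apply/cvg_ex; exists l | exact: cvg_lim].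
Unshelve. all: by end_near.
Qed.

Lemma has_derivative_in_continuous D u x l : has_derivative_in D u x l ->
  u y @[y --> within D (nbhs x)] --> u x.
Proof.
move=> H.
(* This expression equals [u y] off [x]; the point [y = x], absent from the punctured filter, is
   treated separately below. *)
have : u x + (u y - u x) / (y - x) * (y - x) @[y --> within D x^'] --> u x + l * (x - x).
  apply: cvgD; first exact: cvg_cst.
  apply: cvgM => //. apply: cvgB; last exact: cvg_cst.
  by move=> P; apply: (@filterS _ (nbhs x)).
rewrite subrr mulr0 addr0 => /cvgrPdist_lt H2.
apply/cvgrPdist_lt => e e0. have := H2 e e0.
apply: (@filterS _ (nbhs x)) => y Hy Dy.
have [->|yx] := eqVneq y x; first by rewrite subrr normr0.
have := Hy yx Dy. by rewrite divfK ?subr_eq0// subrKC.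
Qed.

Lemma dnbhs_itv_proper (L : R) : 0 < L -> ProperFilter (within `[0, L] (0:R)^').
Proof.
move=> L0. apply: Build_ProperFilter_ex => P HP.
have : \forall y \near (0:R), y != 0 -> `[0,L]%classic y -> P y by [].
move=> /nbhs_ballP[e /= e0 H].
pose y := Num.min (e/2) L.
have y0 : 0 < y by rewrite lt_min L0 divr_gt0.
exists y. apply: H.
- rewrite /ball /= sub0r normrN gtr0_norm // gt_min.
  by apply/orP; left; rewrite ltr_pdivrMr // mulr_natr mulr2n ltrDl.
- by rewrite gt_eqF.
- by rewrite /= in_itv /= ltW //= ge_min lexx orbT.
Qed.

(** The map [h -> L - h] carries punctured neighbourhoods of [0] to those of [L] inside the segment
    and changes the sign of the quotient. Properness of the filter at [0] then makes the limit
    unique. *)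
Lemma has_derivative_in_reflect L u v l k : 0 < L ->
  (forall x, `[0, L]%classic x -> u x = v (L - x)) ->
  has_derivative_in `[0, L] u L l -> has_derivative_in `[0, L] v 0 k -> k = - l.
Proof.
move=> L0 uv Hu Hv.
have PF := dnbhs_itv_proper L0.
have shx : L - h @[h --> within `[0,L] (0:R)^'] --> within `[0,L] L^'.
  move=> P HP.
  have HP' : \forall y \near L, y != L -> `[0,L]%classic y -> P y by [].
  move/nbhs_ballP : HP' => [e e0 H].
  suff : \forall h \near (0:R), h != 0 -> `[0,L]%classic h -> P (L - h) by [].
  apply/nbhs_ballP; exists e => // h hh h0 hL.
  apply: H.
  - by move: hh; rewrite /ball /= opprB addrCA subrr addr0 sub0r normrN.
  - by apply: contra h0 => /eqP h0; apply/eqP; lra.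
  - move: hL; rewrite /= !in_itv /= => /andP[? ?]; apply/andP; split; lra.
have H1 := cvg_comp _ _ shx Hu.
have H2 : (v y - v 0) / (y - 0) @[y --> within `[0,L] (0:R)^'] --> - l.
  apply: cvg_trans (cvgN H1). apply: near_eq_cvg.
  apply: (@filterS _ (nbhs (0:R)) _ setT); last exact: filterT.
  move=> y _ y0 yL.
  rewrite fctE /= !uv //=.
  - rewrite subKr subrr -mulrN -invrN. congr (_ / _). ring.
  - by rewrite in_itv /= lexx ltW.
  - move: yL; rewrite /= !in_itv /= => /andP[? ?]; apply/andP; split; lra.
apply: cvg_unique Hv H2. exact: norm_hausdorff.
Unshelve. all: by end_near.
Qed.

Lemma has_derivative_in0_const (w : R -> R) (X : R) : 0 <= X ->
  (forall t, t \in `]0, X[ -> is_derive t 1 w 0) ->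
  {within `[0, X], continuous w} -> w X = w 0.
Proof.
move=> X0 dw cw; have [c _] := MVT_segment X0 dw cw.
by rewrite mul0r => /eqP; rewrite subr_eq0 => /eqP.
Qed.

(** With [g = u + i v] the system reads [g' = (a + i b) g]. The left-hand side is the real part of
    [exp (- (a + i b) X) g(X)], which has zero derivative in [X]. *)
Lemma rotating_ode_invariant (u v : R -> R) (a b X : R) : 0 <= X ->
  (forall t, `[0, X]%classic t -> has_derivative_in `[0, X] u t (a * u t - b * v t)) ->
  (forall t, `[0, X]%classic t -> has_derivative_in `[0, X] v t (b * u t + a * v t)) ->
  expR (- (a * X)) * (cos (b * X) * u X + sin (b * X) * v X) = u 0.
Proof.
move=> X0 du dv.
pose w t := expR (- (a * t)) * (cos (b * t) * u t + sin (b * t) * v t).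
suff : w X = w 0 by rewrite /w !mulr0 oppr0 expR0 cos0 sin0 !mul1r mul0r addr0.
have wE t : is_derive (t:R) 1 (fun t => expR (- (a * t))) (- a * expR (- (a * t))).
  by apply: is_derive_eq; rewrite /GRing.scale /=; ring.
have cE t : is_derive (t:R) 1 (fun t => cos (b * t)) (- b * sin (b * t)).
  by apply: is_derive_eq; rewrite /GRing.scale /=; ring.
have sE t : is_derive (t:R) 1 (fun t => sin (b * t)) (b * cos (b * t)).
  by apply: is_derive_eq; rewrite /GRing.scale /=; ring.
apply: (has_derivative_in0_const X0) => [t tX|].
  have tX' : nbhs t `[0, X]%classic.
    apply: filterS (near_in_itvoo tX). exact: subset_itv_oo_cc.
  have tX2 : `[0, X]%classic t by exact: subset_itv_oo_cc tX.
  have dut := has_derivative_in_is_derive tX' (du t tX2).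
  have dvt := has_derivative_in_is_derive tX' (dv t tX2).
  rewrite /w. apply: is_derive_eq. rewrite /GRing.scale /=. ring.
apply/subspace_continuousP => t tX.
have cvgw (h : R -> R) (l : R) : is_derive t 1 h l ->
    h y @[y --> within `[0, X] (nbhs t)] --> h t.
  move=> [/derivable1_diffP/differentiable_continuous dh _]; move: dh.
  by apply: cvg_trans; apply: cvg_app; exact: cvg_within.
apply: cvgM; first exact: cvgw (wE t).
by apply: cvgD; apply: cvgM;
   [exact: cvgw (cE t) | exact: has_derivative_in_continuous (du t tX)
   |exact: cvgw (sE t) | exact: has_derivative_in_continuous (dv t tX)].
Qed.

Lemma rotating_ode (u v : R -> R) (a b X : R) : 0 <= X ->
  (forall t, `[0, X]%classic t -> has_derivative_in `[0, X] u t (a * u t - b * v t)) ->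
  (forall t, `[0, X]%classic t -> has_derivative_in `[0, X] v t (b * u t + a * v t)) ->
  u X = expR (a * X) * (cos (b * X) * u 0 - sin (b * X) * v 0) /\
  v X = expR (a * X) * (sin (b * X) * u 0 + cos (b * X) * v 0).
Proof.
move=> X0 du dv.
have eu := rotating_ode_invariant X0 du dv.
(* The pair [(v, -u)] represents [-i g] and solves the same system, so its invariant is the
   imaginary part of the one for [g]. *)
have ev : expR (- (a * X)) * (cos (b * X) * v X + sin (b * X) * (-1 * u X)) = v 0.
  apply: (@rotating_ode_invariant v (fun t => -1 * u t) a b) => // t tX.
    by have := dv t tX; congr has_derivative_in; ring.
  have := has_derivative_inZ (c := -1) (du t tX); congr has_derivative_in; ring.
have e1 : expR (a * X) * expR (- (a * X)) = 1 by rewrite -expRD subrr expR0.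
have cs := cos2Dsin2 (b * X).
rewrite -eu -ev.
set A := expR (a * X) in e1 *; set B := expR (- _) in e1 *.
set c := cos _ in cs *; set s := sin _ in cs *.
split.
- transitivity ((A * B) * (c ^+ 2 + s ^+ 2) * u X); first by rewrite e1 cs !mul1r.
  ring.
- transitivity ((A * B) * (c ^+ 2 + s ^+ 2) * v X); first by rewrite e1 cs !mul1r.
  ring.
Qed.

Lemma complex_ode D g (w : R[i]) X : 0 <= X -> `[0, X]%classic `<=` D ->
  (forall t, D t -> has_derivative_in D (fun y => complex.Re (g y)) t
      (complex.Re (w * g t)) /\
    has_derivative_in D (fun y => complex.Im (g y)) t (complex.Im (w * g t))) ->
  g X = g 0 * cexp (w * X%:C).
Proof.
move=> X0 XD dg.
have [] := @rotating_ode (fun y => complex.Re (g y)) (fun y => complex.Im (g y))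
  (complex.Re w) (complex.Im w) X X0.
- move=> t tX; have [+ _] := dg t (XD t tX).
  move/(has_derivative_in_subset XD); congr has_derivative_in.
  by case: w {dg} => a b; case: (g t).
- move=> t tX; have [_ +] := dg t (XD t tX).
  move/(has_derivative_in_subset XD); congr has_derivative_in.
  by case: w {dg} => a b; case: (g t) => c d /=; rewrite addrC.
case: (g X) => p q /= -> ->; rewrite /cexp.
case: w {dg} => a b; case: (g 0) => c d /=; simpc.
by congr (_ +i* _); ring.
Qed.

(** Since [f'' = - z^2 f = w^2 f], the function [g = f' + w f] satisfies [g' = w g]. It is applied
    with [w = i z] and [w = - i z], and [D] may be a segment or a half-line. *)
Lemma helmholtz_combination D f (z w : R[i]) X : 0 <= X ->
  `[0, X]%classic `<=` D -> C2_in D f ->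
  (forall x, D x -> - derive_in D (derive_in D f) x = z ^+ 2 * f x) ->
  w ^+ 2 = - z ^+ 2 ->
  derive_in D f X + w * f X = (derive_in D f 0 + w * f 0) * cexp (w * X%:C).
Proof.
move=> X0 XD [d1 d2 _] ode wz.
apply: (@complex_ode D (fun y => derive_in D f y + w * f y)) => // t Dt.
have [r1 i1] := derivable_inP (d1 t Dt).
have [r2 i2] := derivable_inP (d2 t Dt).
have f2 : derive_in D (derive_in D f) t = w * (w * f t).
  by rewrite mulrA -expr2 wz mulNr -ode // opprK.
rewrite f2 in r2 i2.
split.
- have := has_derivative_inD r2 (has_derivative_inD
    (has_derivative_inZ (c := complex.Re w) r1) (has_derivative_inZ (c := - complex.Im w) i1)).
  congr has_derivative_in.
    apply/funext => y /=; case: w {wz f2 r2 i2} => a b.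
    by case: (f y) => p q; case: (derive_in D f y) => p' q' /=; ring.
  case: w {wz f2 r2 i2} => a b; case: (f t) => p q.
  case: (derive_in D f t) => p' q' /=; simpc; rewrite /=; ring.
- have := has_derivative_inD i2 (has_derivative_inD
    (has_derivative_inZ (c := complex.Im w) r1) (has_derivative_inZ (c := complex.Re w) i1)).
  congr has_derivative_in.
    apply/funext => y /=; case: w {wz f2 r2 i2} => a b.
    by case: (f y) => p q; case: (derive_in D f y) => p' q' /=; ring.
  case: w {wz f2 r2 i2} => a b; case: (f t) => p q.
  case: (derive_in D f t) => p' q' /=; simpc; rewrite /=; ring.
Qed.

Lemma derive_in_reflect f g (L : R) : 0 < L ->
  derivable_in `[0, L] f L -> derivable_in `[0, L] g 0 ->
  (forall x, `[0, L]%classic x -> f x = g (L - x)) ->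
  derive_in `[0, L] g 0 = - derive_in `[0, L] f L.
Proof.
move=> L0 /derivable_inP[rf imf] /derivable_inP[rg img] fg.
have er := has_derivative_in_reflect L0
  (fun x Dx => congr1 (@complex.Re R) (fg x Dx)) rf rg.
have ei := has_derivative_in_reflect L0
  (fun x Dx => congr1 (@complex.Im R) (fg x Dx)) imf img.
by apply/eqP; rewrite eq_complex er ei; case: (derive_in _ f L) => a b /=; rewrite !eqxx.
Qed.
End DerivativeWithin.

(** Cauchy-Schwarz against the constant vector, obtained by expanding the sum of the squares of
    [d * x i - S], where [S] is the sum and [d] the number of terms. *)
Lemma sqr_sum_le (R : realFieldType) (I : finType) (P : pred I) (x : I -> R) :
  (\sum_(i | P i) x i) ^+ 2 <= #|P|%:R * \sum_(i | P i) x i ^+ 2.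
Proof.
have [P0|P0] := posnP #|P|.
  by rewrite !big_pred0 ?expr0n /= ?mulr0// => i; apply: (card0_eq P0).
set S := \sum_(i | P i) x i; set d := #|P|%:R.
have d0 : 0 < d :> R by rewrite ltr0n.
have : 0 <= \sum_(i | P i) (d * x i - S) ^+ 2.
  by apply: sumr_ge0 => i _; exact: sqr_ge0.
under eq_bigr do rewrite sqrrB exprMn.
rewrite big_split sumrB /= -mulr_sumr sumr_const -/d.
under [X in _ - X]eq_bigr do rewrite -mulr_natl.
rewrite -mulr_sumr -mulr_suml -mulr_sumr -/S.
rewrite -[S ^+ 2 *+ _]mulr_natl -/d => H.
rewrite -(ler_pM2l d0) -subr_ge0. apply: le_trans H _.
by rewrite le_eqVlt; apply/orP; left; apply/eqP; ring.
Qed.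

(** * Energy balance at a single vertex *)

Section VertexScattering.
Set Implicit Arguments.
Unset Strict Implicit.
Variables (R : realType) (Q : finite_quantum_graph R).
Implicit Types (x y : hbond Q -> R) (v : qvertex Q).

(** Forgetting orientation maps the bonds leaving [v] onto the edges containing [v]. It is injective
    because an edge has exactly two vertices, so [v] determines the other end. *)
Lemma card_bonds_origin (v : qvertex Q) :
  #|[pred b : bond Q | origin (inl b) == v]| = degree v.
Proof.
rewrite /degree -(@card_in_imset _ _ (@bond_edge R Q)).
  apply: eq_card => e; rewrite !inE; apply/idP/idP.
    move=> /imsetP[b bv ->]; move: bv; rewrite inE /= => /eqP <-.
    by rewrite /bond_edge (valP b) !inE eqxx.
  move=> /andP[eQ ve]; have e2 := qedges_card2 eQ.
  move: (e2); rewrite (cardsD1 v) ve => /eqP; rewrite add1n eqSS => /cards1P[u eu].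
  have eE : [set v; u]%SET = e by rewrite -(finset.setD1K ve) eu.
  have vuQ : ([set (v, u).1; (v, u).2] \in qedges Q)%SET by rewrite eE.
  apply/imsetP; exists (exist _ (v, u) vuQ : bond Q); first by rewrite inE /=.
  by rewrite /bond_edge /= eE.
move=> [[v1 u] uQ] [[v1' u'] u'Q]; rewrite !inE /= => /eqP v1v /eqP v1'v.
subst v1 v1'; rewrite /bond_edge /= => uu; apply: val_inj => /=.
have := qedges_card2 uQ; rewrite /= cards2.
case: eqVneq => // vu _.
have : u \in [set v; u']%SET by rewrite -uu !inE eqxx orbT.
by rewrite !inE eq_sym (negPf vu) /= => /eqP ->.
Qed.

Lemma card_leads_origin (v : qvertex Q) :
  #|[pred l : lead Q | origin (inr l) == v]| = qleads v.
Proof.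
rewrite -[RHS]card_ord.
rewrite -(@card_in_image _ _ (fun i : 'I_(qleads v) =>
  Tagged (fun v => 'I_(qleads v)) i : lead Q) predT).
  apply: eq_card => -[u i]; rewrite [LHS]inE /=; apply/eqP/idP.
    by move=> uv; subst u; apply/mapP; exists i; rewrite ?mem_enum.
  by move=> /mapP[j _ /(congr1 tag)].
move=> i j _ _ /eqP; by rewrite eq_Tagged => /eqP.
Qed.

Lemma sum_hbond (V : nmodType) (F : hbond Q -> V) v :
  \sum_(b : hbond Q | origin b == v) F b =
  \sum_(b : bond Q | origin (inl b) == v) F (inl b) +
  \sum_(l : lead Q | origin (inr l) == v) F (inr l).
Proof. exact: big_sumType. Qed.

(** Termwise, [y^2 - x^2 = - (x - y) (x + y) = - c (x + y)], and the last factor sums to zero. *)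
Lemma sum_sqr_incoming x y v (c : R) :
  (forall b, origin b = v -> x b - y b = c) ->
  \sum_(b : hbond Q | origin b == v) (x b + y b) = 0 ->
  \sum_(b : hbond Q | origin b == v) y b ^+ 2 =
  \sum_(b : hbond Q | origin b == v) x b ^+ 2.
Proof.
move=> xy s0; apply/eqP; rewrite -subr_eq0 -sumrB.
rewrite (eq_bigr (fun b => - c * (x b + y b))); first by rewrite -mulr_sumr s0 mulr0.
by move=> b /eqP bv; rewrite -(xy b bv); ring.
Qed.

(** Let [S] and [T] be the sums of [x] and [x^2] over the bonds at [v]. On a lead [x = c], so the
    vertex condition becomes [(d - n) c = 2 S] and the sum of [y^2] over the bonds is [T + n c^2].
    Cauchy-Schwarz, [S^2 <= d T], then yields the factor [(d - n)^2 + 4 n d = (d + n)^2]. *)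
Lemma sum_sqr_incoming_le x y v (c : R) :
  (forall b, origin b = v -> x b - y b = c) ->
  \sum_(b : hbond Q | origin b == v) (x b + y b) = 0 ->
  (forall l, y (inr l) = 0) ->
  ((degree v)%:R - (qleads v)%:R) ^+ 2 *
    \sum_(b : bond Q | origin (inl b) == v) y (inl b) ^+ 2 <=
  ((qleads v)%:R + (degree v)%:R) ^+ 2 *
    \sum_(b : bond Q | origin (inl b) == v) x (inl b) ^+ 2.
Proof.
move=> xy s0 y0; have := sum_sqr_incoming xy s0.
rewrite !sum_hbond.
rewrite [X in _ + X = _](_ : _ = 0) ?addr0; last first.
  by apply: big1 => l _; rewrite y0 expr0n.
rewrite [X in _ = _ + X](_ : _ = (qleads v)%:R * c ^+ 2); last first.
  rewrite -card_leads_origin mulr_natl -sumr_const; apply: eq_bigr => l /eqP lv.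
  by rewrite -(xy (inr l) lv) y0 subr0.
move=> ->; set d := (degree v)%:R; set n := (qleads v)%:R.
move: s0; rewrite sum_hbond.
rewrite [X in _ + X = _](_ : _ = n * c); last first.
  rewrite /n -card_leads_origin mulr_natl -sumr_const; apply: eq_bigr => l /eqP lv.
  by rewrite -(xy (inr l) lv) y0 subr0 addr0.
rewrite [X in X + _ = _](_ : _ =
  2 * \sum_(b : bond Q | origin (inl b) == v) x (inl b) - d * c); last first.
  rewrite /d -card_bonds_origin [_ * c]mulr_natl -sumr_const mulr_sumr -sumrB.
  apply: eq_bigr => b /eqP bv.
  by rewrite -(xy (inl b) bv); ring.
have := sqr_sum_le [pred b : bond Q | origin (inl b) == v] (fun b => x (inl b)).
rewrite card_bonds_origin -/d.
rewrite [X in X ^+ 2]/= [X in _ <= _ * X]/=.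
set S := \sum_(b | _) x _; set T := \sum_(b | _) x _ ^+ 2 => ST Sc.
have n0 : 0 <= n by [].
(* The vertex condition with the leads eliminated. Keeping the factor [d - n] on the left avoids any
   division. *)
have Sc' : (d - n) * c = 2 * S by lra.
have : 4 * n * S ^+ 2 <= 4 * n * (d * T) by apply: ler_wpM2l => //; rewrite mulr_ge0.
have -> : (d - n) ^+ 2 * (T + n * c ^+ 2) =
  (d - n) ^+ 2 * T + n * ((d - n) * c) ^+ 2 by ring.
by rewrite Sc' => ?; nra.
Qed.

(** Squared modulus with values in [R], so that energies are compared in the real field rather than
    in [R[i]], where the library norm lives. *)
Definition sqmod (w : R[i]) : R := complex.Re w ^+ 2 + complex.Im w ^+ 2.

Lemma sqmod_ge0 w : 0 <= sqmod w.
Proof. by rewrite addr_ge0 ?sqr_ge0. Qed.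

Lemma sqmod_eq0 w : (sqmod w == 0) = (w == 0).
Proof. by rewrite paddr_eq0 ?sqr_ge0 // !sqrf_eq0 -(eq_complex w 0). Qed.

Lemma sqmodM w w' : sqmod (w * w') = sqmod w * sqmod w'.
Proof. by case: w => a b; case: w' => c d; rewrite /sqmod /=; ring. Qed.

Lemma sqmodN w : sqmod (- w) = sqmod w.
Proof. by case: w => a b; rewrite /sqmod /= !sqrrN. Qed.

Lemma sqmod_cexp (w : R[i]) : sqmod (cexp w) = expR (2 * complex.Re w).
Proof.
rewrite /cexp sqmodM /sqmod /= expr0n addr0 cos2Dsin2 mulr1 expr2 -expRD.
by congr expR; ring.
Qed.

Lemma bond_revK : involutive (@bond_rev R Q).
Proof. by move=> [[v u] vuQ]; apply: val_inj. Qed.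

Lemma Re_sum (I : finType) (A : pred I) (F : I -> R[i]) :
  complex.Re (\sum_(i | A i) F i) = \sum_(i | A i) complex.Re (F i).
Proof. by apply: (big_morph (@complex.Re R)) => // -[? ?] []. Qed.

Lemma Im_sum (I : finType) (A : pred I) (F : I -> R[i]) :
  complex.Im (\sum_(i | A i) F i) = \sum_(i | A i) complex.Im (F i).
Proof. by apply: (big_morph (@complex.Im R)) => // -[? ?] []. Qed.

(** * From vertex estimates to the whole graph, for abstract amplitudes [P] and [I] *)

Section Scattering.
Variables (P I : hbond Q -> R[i]) (c : qvertex Q -> R[i]).
Hypothesis subPI : forall b, P b - I b = c (origin b).
Hypothesis sumPI : forall v, \sum_(b : hbond Q | origin b == v) (P b + I b) = 0.
Hypothesis leadI : forall l, I (inr l) = 0.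

Let subRe v b : origin b = v -> complex.Re (P b) - complex.Re (I b) = complex.Re (c v).
Proof. by move=> <-; rewrite -subPI; case: (P b) => ? ?; case: (I b). Qed.

Let subIm v b : origin b = v -> complex.Im (P b) - complex.Im (I b) = complex.Im (c v).
Proof. by move=> <-; rewrite -subPI; case: (P b) => ? ?; case: (I b). Qed.

Let sumRe v :
  \sum_(b : hbond Q | origin b == v) (complex.Re (P b) + complex.Re (I b)) = 0.
Proof.
rewrite -[RHS]/(complex.Re (0 : R[i])) -(sumPI v) Re_sum; apply: eq_bigr => b _.
by case: (P b) => ? ?; case: (I b).
Qed.

Let sumIm v :
  \sum_(b : hbond Q | origin b == v) (complex.Im (P b) + complex.Im (I b)) = 0.
Proof.
rewrite -[RHS]/(complex.Im (0 : R[i])) -(sumPI v) Im_sum; apply: eq_bigr => b _.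
by case: (P b) => ? ?; case: (I b).
Qed.

(** The vertex conditions have real coefficients, so real and imaginary parts satisfy them
    separately and the real identity applies to each. *)
Lemma sum_sqmod_incoming v :
  \sum_(b : hbond Q | origin b == v) sqmod (I b) =
  \sum_(b : hbond Q | origin b == v) sqmod (P b).
Proof.
rewrite !big_split /=; congr (_ + _).
  exact: sum_sqr_incoming (@subRe v) (sumRe v).
exact: sum_sqr_incoming (@subIm v) (sumIm v).
Qed.

Lemma sum_sqmod_incoming_le v :
  ((degree v)%:R - (qleads v)%:R) ^+ 2 *
    \sum_(b : bond Q | origin (inl b) == v) sqmod (I (inl b)) <=
  ((qleads v)%:R + (degree v)%:R) ^+ 2 *
    \sum_(b : bond Q | origin (inl b) == v) sqmod (P (inl b)).
Proof.
rewrite !big_split /= !mulrDr; apply: lerD.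
  by apply: (sum_sqr_incoming_le (@subRe v) (sumRe v)) => l; rewrite leadI.
by apply: (sum_sqr_incoming_le (@subIm v) (sumIm v)) => l; rewrite leadI.
Qed.

Variable r : bond Q -> R.
Hypothesis revI : forall b,
  sqmod (I (inl (bond_rev b))) = r b * sqmod (P (inl b)).

Let sum_revI : \sum_(b : bond Q) sqmod (I (inl b)) =
  \sum_(b : bond Q) r b * sqmod (P (inl b)).
Proof.
rewrite (reindex_inj (inv_inj bond_revK)) /=; apply: eq_bigr => b _; exact: revI.
Qed.

(** If [P] vanishes on bonds, reversal makes [I] vanish on bonds, and [leadI] covers the leads. The
    energy identity at each vertex then kills [P] on the leads as well. *)
Lemma amplitudes_eq0 :
  (forall b : bond Q, P (inl b) = 0) -> forall b, P b = 0 /\ I b = 0.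
Proof.
move=> P0.
have I0 b : I b = 0.
  case: b => [b|l]; last exact: leadI.
  apply/eqP; rewrite -sqmod_eq0 -(bond_revK b) revI P0.
  by rewrite /sqmod expr0n /= addr0 mulr0.
move=> b; split=> //; apply/eqP; rewrite -sqmod_eq0; apply/eqP.
have := @psumr_eq0P R (hbond Q) (fun b' => origin b' == origin b)
  (fun b => sqmod (P b)).
apply => //; first by move=> ? _; exact: sqmod_ge0.
rewrite -sum_sqmod_incoming big1 // => b' _.
by rewrite I0 /sqmod expr0n addr0.
Qed.

(** At each vertex the bonds alone carry at most as much of [|P|^2] as of [|I|^2], the leads taking
    the rest. Hence the sum of the nonnegative terms [(1 - r b) |P b|^2] is at most zero, and each
    term vanishes. *)
Lemma amplitudes_eq0_upper : (forall b, r b < 1) -> forall b : bond Q, P (inl b) = 0.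
Proof.
move=> r1 b.
have H : \sum_(b : bond Q) sqmod (P (inl b)) <=
    \sum_(b : bond Q) r b * sqmod (P (inl b)).
  (* Reversal turns the right-hand side into the total of [|I|^2]; grouping both totals by origin
     reduces the claim to one vertex. *)
  rewrite -sum_revI [leLHS](partition_big (fun b => origin (inl b)) predT) //.
  rewrite [leRHS](partition_big (fun b => origin (inl b)) predT) //=.
  apply: ler_sum => v _; have := sum_sqmod_incoming v.
  rewrite !sum_hbond /=.
  rewrite [X in _ + X = _]big1 ?addr0 => [->|l _]; last first.
    by rewrite leadI /sqmod expr0n addr0.
  by rewrite lerDl; apply: sumr_ge0 => l _; exact: sqmod_ge0.
have ge0 b' : predT b' -> 0 <= (1 - r b') * sqmod (P (inl b')).
  by move=> _; rewrite mulr_ge0 ?sqmod_ge0 // subr_ge0 ltW.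
have := psumr_eq0P ge0.
move=> /(_ _ b isT) E; apply/eqP; rewrite -sqmod_eq0.
have : (1 - r b) * sqmod (P (inl b)) == 0.
  apply/eqP/E/eqP; rewrite eq_le sumr_ge0 // andbT.
  under eq_bigr do rewrite mulrBl mul1r.
  by rewrite sumrB subr_le0.
by rewrite mulf_eq0 subr_eq0 gt_eqF.
Qed.

(** The mirror image of the previous argument: vertices bound the total of [|I|^2] by that of
    [k |P|^2], while reversal makes it the total of [r |P|^2] with [r > k]. *)
Lemma amplitudes_eq0_lower : (forall v, qleads v <> degree v) ->
  (forall b,
    ((qleads (origin (inl b)))%:R + (degree (origin (inl b)))%:R) ^+ 2 <
    ((degree (origin (inl b)))%:R - (qleads (origin (inl b)))%:R) ^+ 2 * r b) ->
  forall b : bond Q, P (inl b) = 0.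
Proof.
move=> ub rb b.
pose k (v : qvertex Q) : R :=
  ((qleads v)%:R + (degree v)%:R) ^+ 2 / ((degree v)%:R - (qleads v)%:R) ^+ 2.
have dn0 (v : qvertex Q) : 0 < ((degree v)%:R - (qleads v)%:R) ^+ 2 :> R.
  rewrite lt_neqAle sqr_ge0 andbT eq_sym sqrf_eq0 subr_eq0 eqr_nat.
  by apply/eqP => e; exact: (ub v).
have H : \sum_(b : bond Q) r b * sqmod (P (inl b)) <=
    \sum_(b : bond Q) k (origin (inl b)) * sqmod (P (inl b)).
  rewrite -sum_revI [leLHS](partition_big (fun b => origin (inl b)) predT) //.
  rewrite [leRHS](partition_big (fun b => origin (inl b)) predT) //=.
  apply: ler_sum => v _; have := sum_sqmod_incoming_le v.
  rewrite mulrC -ler_pdivlMr // mulrAC -/(k v) mulr_sumr => /le_trans; apply.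
  by rewrite le_eqVlt; apply/orP; left; apply/eqP; apply: eq_bigr => ? /eqP <-.
have rk b' : 0 < r b' - k (origin (inl b')).
  by rewrite subr_gt0 /k ltr_pdivrMr // mulrC; exact: rb.
have ge0 b' : predT b' -> 0 <= (r b' - k (origin (inl b'))) * sqmod (P (inl b')).
  by move=> _; rewrite mulr_ge0 ?sqmod_ge0 // ltW.
have := psumr_eq0P ge0.
move=> /(_ _ b isT) E; apply/eqP; rewrite -sqmod_eq0.
have : (r b - k (origin (inl b))) * sqmod (P (inl b)) == 0.
  apply/eqP/E/eqP; rewrite eq_le sumr_ge0 // andbT.
  under eq_bigr do rewrite mulrBl.
  by rewrite sumrB subr_le0.
by rewrite mulf_eq0 gt_eqF.
Qed.
End Scattering.
End VertexScattering.

(** * Wave amplitudes of a resonant state with [z] off the real axis *)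

Section Waves.
Set Implicit Arguments.
Unset Strict Implicit.
Local Open Scope complex_scope.
Variables (R : realType) (Q : finite_quantum_graph R) (z : R[i]).
Variable f : hbond Q -> R -> R[i].
Hypothesis Imz : complex.Im z != 0.
Hypothesis C2f : in_C2 f.
Hypothesis kirf : kirchhoff f.
Hypothesis odef : forall (b : hbond Q) (x : R), bond_domain b x ->
  - derive_in (bond_domain b) (derive_in (bond_domain b) (f b)) x = z ^+ 2 * f b x.
Hypothesis leadf : forall (l : lead Q) (x : R), bond_domain (inr l) x ->
  f (inr l) x = f (inr l) 0 * cexp ('i%C * z * x%:C).

Definition outgoing (b : hbond Q) : R[i] :=
  derive_in (bond_domain b) (f b) 0 + 'i * z * f b 0.
Definition incoming (b : hbond Q) : R[i] :=
  derive_in (bond_domain b) (f b) 0 - 'i * z * f b 0.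

Let iz_neq0 : 'i * z != 0 :> R[i].
Proof.
apply/eqP => /(congr1 (@complex.Re R)) /=; case: z Imz => a b /= b0.
rewrite mul0r mul1r sub0r => /eqP.
by rewrite oppr_eq0 (negPf b0).
Qed.

Let iz_sqr : ('i * z) ^+ 2 = - z ^+ 2 :> R[i].
Proof. by rewrite exprMn sqr_i mulN1r. Qed.

Lemma bond_length_gt0 (b : bond Q) : 0 < bond_length b.
Proof. exact: qlength_gt0 (valP b). Qed.

Lemma bond_length_rev (b : bond Q) : bond_length (bond_rev b) = bond_length b.
Proof. by rewrite /bond_length /bond_edge /= finset.setUC. Qed.

Lemma bond_domain_segment (b : hbond Q) x :
  bond_domain b x -> 0 <= x /\ `[0, x]%classic `<=` bond_domain b.
Proof.
case: b => [b|l] /=; rewrite in_itv /=.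
  move=> /andP[x0 xL]; split=> // y /=; rewrite !in_itv /=.
  by move=> /andP[-> /le_trans]; exact.
by rewrite andbT => x0; split=> // y /=; rewrite !in_itv /= => /andP[-> _].
Qed.

Lemma outgoing_propagation b x : bond_domain b x ->
  derive_in (bond_domain b) (f b) x + 'i * z * f b x =
  outgoing b * cexp ('i * z * x%:C).
Proof.
move=> bx; have [x0 sub] := bond_domain_segment bx.
apply: helmholtz_combination x0 sub (C2f.1 b) _ iz_sqr; exact: odef.
Qed.

Lemma incoming_propagation b x : bond_domain b x ->
  derive_in (bond_domain b) (f b) x - 'i * z * f b x =
  incoming b * cexp (- ('i * z) * x%:C).
Proof.
move=> bx; have [x0 sub] := bond_domain_segment bx.
(* The difference is rewritten as [f' + w f] with [w = - i z]. *)
rewrite /incoming -!(mulNr ('i * z)).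
apply: helmholtz_combination x0 sub (C2f.1 b) _ _; first exact: odef.
by rewrite sqrrN iz_sqr.
Qed.

(** Reversal gives [f_rev(0) = f_b(L)] and [f_rev'(0) = - f_b'(L)], so the incoming amplitude of the
    reverse bond is minus the outgoing combination transported to [x = L]. *)
Lemma incoming_rev (b : bond Q) :
  incoming (inl (bond_rev b)) =
  - outgoing (inl b) * cexp ('i * z * (bond_length b)%:C).
Proof.
have bL : bond_domain (inl b) (bond_length b).
  by rewrite /= in_itv /= lexx andbT ltW // bond_length_gt0.
rewrite mulNr -outgoing_propagation // /incoming opprD.
have L0 := bond_length_gt0 b.
have drev :
   derive_in (bond_domain (inl (bond_rev b))) (f (inl (bond_rev b))) 0 =
   - derive_in (bond_domain (inl b)) (f (inl b)) (bond_length b).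
  rewrite /= bond_length_rev; apply: derive_in_reflect => //.
  - have [+ _ _] := C2f.1 (inl b); exact.
  - have [+ _ _] := C2f.1 (inl (bond_rev b)); rewrite /= bond_length_rev; apply.
    by rewrite /= in_itv /= lexx ltW.
  - exact: C2f.2.
by rewrite drev (C2f.2 b _ bL) subrr.
Qed.

Lemma sub_outgoing_incoming b : outgoing b - incoming b = 2 * ('i * z * f b 0).
Proof. rewrite /outgoing /incoming; ring. Qed.

(** Writing [2 i z f] at [0] and at [1] through the two amplitudes and comparing with the radiation
    condition gives [I (exp (- i z) - exp (i z)) = 0]. The two exponentials have different moduli
    because [Im z] is nonzero. *)
Lemma incoming_lead l : incoming (inr l) = 0.
Proof.
(* Any positive abscissa would do in place of [1]. *)
have d1 : bond_domain (inr l) (1 : R) by rewrite /= in_itv /= ler01.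
have o1 := outgoing_propagation d1; have i1 := incoming_propagation d1.
have f2 : 2 * ('i * z * f (inr l) 1) = outgoing (inr l) * cexp ('i * z * 1%:C) -
    incoming (inr l) * cexp (- ('i * z) * 1%:C) by rewrite -o1 -i1; ring.
move: f2; rewrite (leadf d1) -/(1%:C).
set e := cexp ('i * z * _); set e' := cexp (- _ * _) => f2.
have /eqP : incoming (inr l) * (e' - e) = 0.
  transitivity ((outgoing (inr l) - incoming (inr l)) * e -
    2 * ('i * z * f (inr l) 0) * e + incoming (inr l) * e' -
    outgoing (inr l) * e + 2 * ('i * z * (f (inr l) 0 * e))); first by ring.
  by rewrite f2 sub_outgoing_incoming; ring.
rewrite mulf_eq0 (subr_eq0 e') => /orP[/eqP//|/eqP/(congr1 (@sqmod R))].
rewrite /e /e' !sqmod_cexp => /expR_inj.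
case: z Imz => a b /= b0 ab; exfalso; move/eqP: b0; apply; lra.
Qed.

Lemma wave_eq0 b x :
  outgoing b = 0 -> incoming b = 0 -> bond_domain b x -> f b x = 0.
Proof.
move=> o0 i0 bx; have := outgoing_propagation bx; have := incoming_propagation bx.
rewrite o0 i0 !mul0r => i1 o1.
have /eqP : 2 * ('i * z * f b x) = 0 by rewrite -[RHS]subr0 -{1}o1 -i1; ring.
by rewrite !mulf_eq0 (pnatr_eq0 _ 2) /= -mulf_eq0 (negPf iz_neq0) /= => /eqP.
Qed.

(** The constant [c v] of the scattering section: [2 i z] times the common value of [f] at [v]. The
    default [0] concerns only vertices from which no bond or lead starts. *)
Let phi (v : qvertex Q) : R[i] :=
  if [pick b : hbond Q | origin b == v] is Some b
  then 2 * ('i * z * f b 0) else 0.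

Let sub_phi b : outgoing b - incoming b = phi (origin b).
Proof.
rewrite sub_outgoing_incoming /phi; case: pickP => [b' /eqP bb'|/(_ b)].
  by rewrite (kirf.1 _ _ bb').
by rewrite eqxx.
Qed.

Let sum_phi v :
  \sum_(b : hbond Q | origin b == v) (outgoing b + incoming b) = 0.
Proof.
rewrite (eq_bigr (fun b => 2 * derive_in (bond_domain b) (f b) 0)).
  by rewrite -mulr_sumr kirf.2 mulr0.
by move=> b _; rewrite /outgoing /incoming; ring.
Qed.

(** Supplies the factor [r b] of the scattering section: it is below [1] exactly when [Im z] is
    positive. *)
Let sqmod_incoming_rev (b : bond Q) : sqmod (incoming (inl (bond_rev b))) =
  expR (- (2 * complex.Im z * bond_length b)) * sqmod (outgoing (inl b)).
Proof.
rewrite incoming_rev sqmodM sqmodN sqmod_cexp mulrC; congr (expR _ * _).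
by case: z => a c /=; ring.
Qed.

Lemma wave_upper : 0 < complex.Im z -> forall b x, bond_domain b x -> f b x = 0.
Proof.
move=> s0 b x.
have out0 : forall b : bond Q, outgoing (inl b) = 0.
  apply: (amplitudes_eq0_upper sub_phi sum_phi incoming_lead
    sqmod_incoming_rev) => b'.
  by rewrite expR_lt1 oppr_lt0 !mulr_gt0 // bond_length_gt0.
have [Pb0 Ib0] :=
  amplitudes_eq0 sub_phi sum_phi incoming_lead sqmod_incoming_rev out0 b.
exact: wave_eq0.
Qed.

Lemma wave_lower : (forall v : qvertex Q, qleads v <> degree v) ->
  (forall b : bond Q,
    ((qleads (origin (inl b)))%:R + (degree (origin (inl b)))%:R) ^+ 2 <
    ((degree (origin (inl b)))%:R - (qleads (origin (inl b)))%:R) ^+ 2 *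
      expR (- (2 * complex.Im z * bond_length b))) ->
  forall b x, bond_domain b x -> f b x = 0.
Proof.
move=> ub rb b x.
have out0 :=
  amplitudes_eq0_lower sub_phi sum_phi incoming_lead sqmod_incoming_rev ub rb.
have [Pb0 Ib0] :=
  amplitudes_eq0 sub_phi sum_phi incoming_lead sqmod_incoming_rev out0 b.
exact: wave_eq0.
Qed.
End Waves.

(** * Translation into bounds on the imaginary part of a resonance *)

Section ResonanceBounds.
Set Implicit Arguments.
Unset Strict Implicit.
Variables (R : realType) (Q : finite_quantum_graph R).

Lemma resonance_Im_le0 (z : R[i]) : is_resonance Q z -> complex.Im z <= 0.
Proof.
move=> [f [C2f [b [x [bx fbx]]] kirf odef leadf]].
rewrite leNgt; apply/negP => z0.
by apply: fbx; apply: (wave_upper _ C2f kirf odef leadf z0 bx); rewrite gt_eqF.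
Qed.

(** For an unbalanced vertex, half the logarithm of the factor [((n + d) / (d - n))^2] in the energy
    estimate. *)
Definition vertex_rate (v : qvertex Q) : R :=
  ln ((qleads v)%:R + (degree v)%:R) - ln `|(degree v)%:R - (qleads v)%:R|.

Hypothesis unbalanced : forall v : qvertex Q, qleads v <> degree v.

(** A nonzero integer has absolute value at least [1]. Its logarithm is therefore nonnegative, which
    later allows it to be dropped from the rate. *)
Lemma norm_unbalanced_ge1 (v : qvertex Q) :
  1 <= `|(degree v)%:R - (qleads v)%:R| :> R.
Proof.
have := @unbalanced v; case: (ltngtP (qleads v) (degree v)) => // h _.
  by rewrite -natrB 1?ltnW // normr_nat ler1n subn_gt0.
by rewrite distrC -natrB 1?ltnW // normr_nat ler1n subn_gt0.
Qed.

Lemma norm_unbalanced_le (v : qvertex Q) :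
  `|(degree v)%:R - (qleads v)%:R| <= (qleads v)%:R + (degree v)%:R :> R.
Proof. by rewrite (le_trans (ler_normB _ _)) // !normr_nat addrC. Qed.

Lemma unbalanced_sum_gt0 (v : qvertex Q) :
  0 < (qleads v)%:R + (degree v)%:R :> R.
Proof.
apply: lt_le_trans (norm_unbalanced_le v).
exact: lt_le_trans (norm_unbalanced_ge1 v).
Qed.

Lemma vertex_rate_ge0 v : 0 <= vertex_rate v.
Proof.
rewrite subr_ge0 ler_ln ?posrE ?unbalanced_sum_gt0 ?norm_unbalanced_le //.
exact: lt_le_trans (norm_unbalanced_ge1 v).
Qed.

(** If [Im z < - K / Lmin], then [- Im z * L_b] exceeds [K], hence the rate at the origin of every
    bond [b], and [wave_lower] forces [f = 0]. Leaving [K] free serves both the supremum and the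
    uniform bound. *)
Lemma resonance_Im_ge (z : R[i]) (Lmin K : R) : 0 < Lmin ->
  (forall e, e \in qedges Q -> Lmin <= qlength e) ->
  (forall v : qvertex Q, vertex_rate v <= K) ->
  is_resonance Q z -> - (K / Lmin) <= complex.Im z.
Proof.
move=> L0 Lle vK [f [C2f [b [x [bx fbx]]] kirf odef leadf]].
(* A vertex is available because the nonzero state lives on some bond or lead. *)
have K0 : 0 <= K := le_trans (vertex_rate_ge0 (origin b)) (vK (origin b)).
rewrite leNgt; apply/negP => zK.
have z0 : complex.Im z < 0.
  by apply: lt_le_trans zK _; rewrite oppr_le0 divr_ge0 // ltW.
apply: fbx; apply: (wave_lower _ C2f kirf odef leadf unbalanced _ bx).
  by rewrite lt_eqF.
move=> b'; set v := origin (inl b').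
have n1 := norm_unbalanced_ge1 v.
have nd0 := unbalanced_sum_gt0 v.
have dn0 : 0 < `|(degree v)%:R - (qleads v)%:R| :> R by exact: lt_le_trans n1.
(* Replacing [(d - n)^2] by [|d - n|^2] gives a positive base, and taking logarithms makes the
   inequality linear. *)
rewrite -[X in _ < X * _]real_normK ?num_real // -ltr_ln ?posrE;
  rewrite ?mulr_gt0 ?exprn_gt0 ?expR_gt0 //.
rewrite [ltRHS]lnM ?posrE ?exprn_gt0 ?expR_gt0 //.
rewrite (lnXn 2 nd0) (lnXn 2 dn0) [X in _ < _ + X]expRK !mulr2n.
have := vK v; rewrite /vertex_rate.
have Lb : Lmin <= bond_length b' by exact: Lle (valP b').
have : K < - complex.Im z * bond_length b'.
  have : K < - complex.Im z * Lmin by rewrite -ltr_pdivrMr // ltrNr.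
  by move=> /lt_le_trans; apply; rewrite ler_pM2l // oppr_gt0.
lra.
Qed.
End ResonanceBounds.

Theorem lemma1 (R : realType) (Q : nat -> finite_quantum_graph R)
    (D n0 : nat) (Lmin Lmax : R)
    (Lmin_gt0 : 0 < Lmin) (Lmin_le_Lmax : Lmin <= Lmax)
    (degree_le : forall N (v : qvertex (Q N)), (degree v <= D)%N)
    (leads_le : forall N (v : qvertex (Q N)), (qleads v <= n0)%N)
    (length_bounds : forall N (e : {set qvertex (Q N)}), e \in qedges (Q N) ->
       Lmin <= qlength e <= Lmax)
    (unbalanced : forall N (v : qvertex (Q N)), qleads v <> degree v) :
  (forall N, resonances (Q N) `<=`
     strip (- (1 / Lmin *
               sup [set ln ((qleads v)%:R + (degree v)%:R)
                        - ln `|(degree v)%:R - (qleads v)%:R|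
                   | v in [set: qvertex (Q N)]])) 0) /\
  (forall N, resonances (Q N) `<=` strip (- (ln (D%:R + n0%:R) / Lmin)) 0).
Proof.
(* This is the second bound, and it also provides the upper bound needed to make the supremum in the
   first one meaningful. *)
have rate_le N (v : qvertex (Q N)) : vertex_rate v <= ln (D%:R + n0%:R).
  have n1 := @norm_unbalanced_ge1 R (Q N) (unbalanced N) v.
  rewrite /vertex_rate lerBlDr ler_wpDr ?ln_ge0 //.
  have le : ((qleads v)%:R + (degree v)%:R : R) <= D%:R + n0%:R.
    by rewrite addrC lerD // ler_nat.
  have nd0 := @unbalanced_sum_gt0 R (Q N) (unbalanced N) v.
  by rewrite ler_ln ?posrE // (lt_le_trans nd0).
have Lle N e : e \in qedges (Q N) -> Lmin <= qlength e.
  by move=> /length_bounds/andP[].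
split=> N z zN; exists (complex.Re z) => //; exists (complex.Im z); try by case: (z).
all: rewrite /= in_itv /= (resonance_Im_le0 zN) andbT.
  rewrite div1r mulrC.
  apply: (resonance_Im_ge (unbalanced N) Lmin_gt0 (Lle N)) => // v.
  apply: ub_le_sup; last by exists v.
  by exists (ln (D%:R + n0%:R)) => _ [u _ <-]; exact: rate_le.
exact: (resonance_Im_ge (unbalanced N) Lmin_gt0 (Lle N)).
Qed.
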